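(* For any $n\in\mathbb{N}$, the number of fundamental models in the probability simplex $\Delta_n$ is finite.
   Context: $\Delta_n=\{p\in\mathbb{R}^{n+1}\mid \sum_i p_i=1,\ p_i\ge 0\}$. A reduced model in $\Delta_n$ is given by a collection of $n+1$ triples $(c_i,\nu_i,\mu_i)_{i=0}^n$ with $c_i\in\mathbb{R}_{>0}$ and $\nu_i,\mu_i\in\mathbb{N}=\{0,1,2,\ldots\}$ such that the pairs $(\nu_i,\mu_i)$ are pairwise distinct and all different from $(0,0)$, and $\sum_{i=0}^n c_i t^{\nu_i}(1-t)^{\mu_i}=1$ for all $t\in[0,1]$; it is the image of $p:[0,1]\to\Delta_n$, $t\mapsto (c_it^{\nu_i}(1-t)^{\mu_i})_{i=0}^n$. Models are counted up to reordering of the coordinates, i.e. as sets of triples. A reduced model is fundamental if, given the exponent pairs $(\nu_i,\mu_i)$, the scalings $c_i$ are uniquely determined by the constraint $\sum_{i=0}^n c_i t^{\nu_i}(1-t)^{\mu_i}=1$ (as a polynomial identity in $t$). *)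

(* Defs.v *)
From mathcomp Require Import all_boot all_order all_algebra.
From mathcomp Require Import all_classical all_reals.

Set Implicit Arguments.
Unset Strict Implicit.
Unset Printing Implicit Defensive.

Import Order.TTheory GRing.Theory Num.Theory.

Local Open Scope classical_set_scope.
Local Open Scope ring_scope.

Record is_reduced_model (R : realType) (n : nat)
    (c : 'I_n.+1 -> R) (nu mu : 'I_n.+1 -> nat) : Prop := IsReducedModel {
  scaling_gt0 : forall i, 0 < c i ;
  exponents_distinct : forall i j, i != j -> (nu i, mu i) <> (nu j, mu j) ;
  exponents_neq0 : forall i, (nu i, mu i) <> (0%N, 0%N) ;
  sum_eq1 : forall t : R, 0 <= t <= 1 ->
    \sum_(i < n.+1) c i * t ^+ nu i * (1 - t) ^+ mu i = 1
}.

(* Scalings are positive by definition, so uniqueness is among positive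
   families. Uniqueness among all real families is equivalent here, since a
   small perturbation of a positive family stays positive. *)
Definition is_fundamental_model (R : realType) (n : nat)
    (c : 'I_n.+1 -> R) (nu mu : 'I_n.+1 -> nat) : Prop :=
  is_reduced_model c nu mu /\
  forall c' : 'I_n.+1 -> R, (forall i, 0 < c' i) ->
    \sum_(i < n.+1) c' i *: ('X^(nu i) * (1 - 'X) ^+ mu i) = 1 :> {poly R} ->
    forall i, c' i = c i.

(* Passing to the set of triples identifies models that differ only by a
   reordering of the coordinates. It loses nothing else, because the triples
   of a reduced model are pairwise distinct. *)
Definition fundamental_models (R : realType) (n : nat) :
    set (set (R * nat * nat)) :=
  [set M | exists (c : 'I_n.+1 -> R) (nu mu : 'I_n.+1 -> nat),
     is_fundamental_model c nu mu /\ M = range (fun i => (c i, nu i, mu i))].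

Arguments fundamental_models R n : clear implicits.

(* Main.v *)
(* Uniqueness of the positive scalings makes the polynomials
   f_i = X^(nu_i) (1 - X)^(mu_i) of a fundamental model linearly independent.
   For the derivation D = X (1 - X) d/dX one has D^k f_i = g_(k,i) f_i with
   deg g_(k,i) <= k. Applying D^k, 0 <= k <= n, to sum_i c_i f_i = 1 gives a
   square linear system for the c_i f_i with matrix G = (g_(k,i)), whose
   determinant is nonzero because the Wronskian of linearly independent
   polynomials is. By Cramer's rule det G * (c_i f_i) is a minor of G, hence
   nu_i + mu_i <= n^2. So there are finitely many exponents, and they
   determine the scalings. *)
Require Import Defs.
From mathcomp Require Import all_boot all_order all_algebra.
From mathcomp Require Import all_classical all_reals.
From mathcomp Require Import ring zify.

Set Implicit Arguments.
Unset Strict Implicit.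
Unset Printing Implicit Defensive.

Import Order.TTheory GRing.Theory Num.Theory.

Local Open Scope ring_scope.

(** * Zeros of polynomials and constant ratios *)

(** The points [1 / (i + 1)] with [i < size p] are distinct and lie in the interval; they are too
    many to be all roots. *)
Lemma poly_nonroot_itv (K : numFieldType) (p : {poly K}) :
  p != 0 -> exists2 t, 0 <= t <= 1 & p.[t] != 0.
Proof.
move=> p_neq0; pose rs := [seq i.+1%:R^-1 | i <- iota 0 (size p)] : seq K.
have /allPn[_ /mapP[i _ ->]] : ~~ all (root p) rs.
  apply: contra_neqN p_neq0 => /roots_geq_poly_eq0; apply.
    rewrite map_inj_uniq ?iota_uniq // => i j /invr_inj /eqP.
    by rewrite eqr_nat eqSS => /eqP.
  by rewrite size_map size_iota.
exists i.+1%:R^-1 => //.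
by rewrite invr_ge0 ler0n invf_le1 ?ltr0n // ler1n.
Qed.

(** This is [(w / u)' = 0] without fractions. Subtracting from [w] the multiple of [u] that agrees
    with it at a non-root [z] of [u] leaves [r] with [u r' = r u'] and [r(z) = 0]. If [r] had a zero
    of finite order [m + 1] at [z], the left side would vanish there to order exactly [m], the right
    side to a higher order. *)
Lemma deriv_eq_scale (K : numFieldType) (u w : {poly K}) :
  u != 0 -> u * w^`() = w * u^`() -> exists a, w = a *: u.
Proof.
move=> u_neq0 uw; have [z _ uz_neq0] := poly_nonroot_itv u_neq0.
exists (w.[z] / u.[z]); apply/eqP; rewrite -subr_eq0; apply/negPn/negP.
set r := w - _ => r_neq0.
have ur : u * r^`() = r * u^`().
  rewrite /r derivB derivZ mulrBr mulrBl uw -scalerAl -scalerAr.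
  by rewrite [u * _]mulrC [_ * u]mulrC.
have rz : root r z by rewrite /root !hornerE divfK ?subrr.
have [[|m] [s]] := multiplicity_XsubC r z; rewrite r_neq0 /= => sz r_def.
  by move: rz sz; rewrite r_def mulr1 => ->.
have /(mulIf (expf_neq0 m (negbT (polyXsubC_eq0 z)))) : 
   (u * (s^`() * ('X - z%:P) + s *+ m.+1)) * ('X - z%:P) ^+ m =
   (s * ('X - z%:P) * u^`()) * ('X - z%:P) ^+ m.
  move: ur; rewrite r_def derivM deriv_exp derivXsubC mul1r /= exprS.
  rewrite -(mulr_natr s) -(mulr_natr (_ ^+ m)).
  move: ('X - z%:P) (_ ^+ m) s^`() u^`() (m.+1%:R : {poly K}) => y ym ds du k ur.
  by transitivity (s * (y * ym) * du); [rewrite -ur; ring|ring].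
move/(congr1 (horner^~ z)); rewrite !hornerE subrr !(mulr0, mul0r, add0r).
by move/eqP; rewrite hornerMn mulf_eq0 (negPf uz_neq0) mulrn_eq0 /= -/(root s z) (negPf sz).
Qed.

(** * Determinants: the Wronskian of a scaled derivation and degrees of cofactors *)

Section ScaledDerivation.
Variables (K : numFieldType) (p : {poly K}).
Hypothesis p_neq0 : p != 0.

Definition scaled_deriv (f : {poly K}) := p * f^`().
Local Notation D := scaled_deriv.

Lemma scaled_derivM f g : D (f * g) = D f * g + f * D g.
Proof. by rewrite /D derivM; ring. Qed.

Lemma scaled_deriv_sum (I : Type) (r : seq I) (F : I -> {poly K}) :
  D (\sum_(i <- r) F i) = \sum_(i <- r) D (F i).
Proof. by rewrite /D raddf_sum mulr_sumr. Qed.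

(* Eliminating [v ord_max] between a relation and its derivative gives a
   shorter relation, so by induction the ratios [v i / v ord_max] have
   derivative 0, i.e. are constant. *)
Lemma wronskian_kernel0 n (f v : 'I_n -> {poly K}) :
  (forall l : 'I_n -> K, \sum_i l i *: f i = 0 -> forall i, l i = 0) ->
  (forall k, (k < n)%N -> \sum_i v i * iter k D (f i) = 0) ->
  forall i, v i = 0.
Proof.
elim: n f v => [|n IHn] f v f_free rel; first by case.
pose w := widen_ord (leqnSn n).
have fw_free l : \sum_i l i *: f (w i) = 0 -> forall i, l i = 0.
  move=> l0 i; pose l' (j : 'I_n.+1) := if insub (val j) is Some k then l k else 0.
  have l'w j : l' (w j) = l j by rewrite /l' /= valK.
  have l'max : l' ord_max = 0 by rewrite /l' insubF //= ltnn.
  rewrite -l'w; apply: f_free.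
  rewrite big_ord_recr /= l'max scale0r addr0 -[RHS]l0.
  by apply: eq_bigr => j _; rewrite l'w.
have [v0|v_neq0] := eqVneq (v ord_max) 0.
  have vw0 : forall i, v (w i) = 0.
    apply: IHn fw_free _ => k k_lt; have := rel k (ltnW k_lt).
    by rewrite big_ord_recr /= v0 mul0r addr0.
  move=> i; case: (unliftP ord_max i) => [j ->|->//]; rewrite -[RHS](vw0 j).
  by congr v; apply: val_inj; rewrite /= /bump leqNgt ltn_ord.
pose u i := v ord_max * D (v (w i)) - v (w i) * D (v ord_max).
have u0 : forall i, u i = 0.
  apply: IHn fw_free _ => k k_lt.
  (* Applying [D] to relation [k] gives this sum plus relation [k + 1], which is still among the
     hypotheses. *)
  have relD : \sum_i D (v i) * iter k D (f i) = 0.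
    have : D (\sum_i v i * iter k D (f i)) = 0.
      by rewrite (rel k (ltnW k_lt)) /D deriv0 mulr0.
    rewrite scaled_deriv_sum; under eq_bigr do rewrite scaled_derivM -iterS.
    by rewrite big_split /= [X in _ + X](rel k.+1) // addr0.
  have /eqP := rel k (ltnW k_lt); rewrite big_ord_recr /= addr_eq0 => /eqP relk.
  move/eqP: relD; rewrite big_ord_recr /= addr_eq0 => /eqP relDk.
  transitivity (v ord_max * (\sum_i D (v (w i)) * iter k D (f (w i)))
                - D (v ord_max) * (\sum_i v (w i) * iter k D (f (w i)))).
    by rewrite !mulr_sumr -sumrB; apply: eq_bigr => i _; rewrite /u; ring.
  by rewrite relk relDk; ring.
have /choice[a va] : forall i, exists a, v (w i) = a *: v ord_max.
  move=> i; apply: deriv_eq_scale => //; apply: (mulfI p_neq0).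
  by have /eqP := u0 i; rewrite subr_eq0 => /eqP; rewrite /D mulrCA => ->; ring.
(* Dividing relation [0] by [v ord_max] leaves a constant-coefficient relation whose last
   coefficient is 1, against freeness. *)
pose l (j : 'I_n.+1) := if insub (val j) is Some k then a k else 1.
have lw j : l (w j) = a j by rewrite /l /= valK.
have lmax : l ord_max = 1 by rewrite /l insubF //= ltnn.
suff /f_free/(_ ord_max)/eqP : \sum_i l i *: f i = 0 by rewrite lmax oner_eq0.
apply: (mulfI v_neq0); rewrite mulr0 -[RHS](rel 0%N) // mulr_sumr.
rewrite !big_ord_recr /= lmax scale1r; congr (_ + _); apply: eq_bigr => j _.
by rewrite lw va -scalerAl -scalerAr.
Qed.

(** Over the integral domain [{poly K}] a zero determinant yields a nonzero kernel vector with
    polynomial entries, which [wronskian_kernel0] excludes. *)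
Lemma wronskian_neq0 n (f : 'I_n -> {poly K}) :
  (forall l : 'I_n -> K, \sum_i l i *: f i = 0 -> forall i, l i = 0) ->
  \det (\matrix_(k < n, i < n) iter k D (f i)) != 0.
Proof.
move=> f_free; rewrite -det_tr; apply/det0P => -[v v_neq0 /matrixP vW].
case/eqP: v_neq0; apply/rowP => i; rewrite mxE.
apply: (wronskian_kernel0 f_free) => k k_lt.
have := vW 0 (Ordinal k_lt); rewrite !mxE => vWk.
rewrite -[RHS]vWk; by apply: eq_bigr => j _; rewrite !mxE.
Qed.

End ScaledDerivation.

Lemma size_cofactor_leq (K : idomainType) n m (A : 'M[{poly K}]_n.+1) i j :
  (forall k l, (size (A k l) <= m.+1)%N) -> (size (cofactor A i j) <= (n * m).+1)%N.
Proof.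
move=> A_le; rewrite expand_cofactor; apply: (leq_trans (size_sum _ _ _)).
apply/bigmax_leqP => s _; rewrite mulr_sign.
have size_sign (b : bool) (q : {poly K}) : size (if b then - q else q) = size q.
  by case: b; rewrite ?size_polyN.
rewrite size_sign.
apply: (leq_trans (size_poly_prod_leq _ _)).
rewrite leq_subLR addnS ltnS.
apply: leq_trans (_ : (\sum_(k | i != k) m.+1 <= _)%N); first exact: leq_sum.
rewrite sum_nat_const.
have -> : #|(fun k => i != k)| = n.
  transitivity #|predC1 i|; last by rewrite cardC1 card_ord.
  by apply: eq_card => k; rewrite !inE eq_sym.
by rewrite mulnS.
Qed.

(** * Degree bound for free families of products of powers of [X] and [1 - X] *)

Section Monomials.
Variable K : numFieldType.

Definition monomial (a b : nat) : {poly K} := 'X^a * (1 - 'X) ^+ b.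

Local Notation D := (scaled_deriv ('X * (1 - 'X) : {poly K})).

Lemma oneBX_neq0 : 1 - 'X != 0 :> {poly K}.
Proof. by rewrite -opprB oppr_eq0 polyXsubC_eq0. Qed.

Lemma size_oneBX : size (1 - 'X : {poly K}) = 2%N.
Proof. by rewrite -opprB size_polyN size_XsubC. Qed.

Lemma monomial_neq0 a b : monomial a b != 0.
Proof. by rewrite mulf_neq0 ?expf_neq0 ?polyX_eq0 ?oneBX_neq0. Qed.

Lemma size_monomial a b : size (monomial a b) = (a + b).+1.
Proof.
have b_neq0 := expf_neq0 b oneBX_neq0.
rewrite size_mul ?expf_neq0 ?polyX_eq0 ?oneBX_neq0 // size_polyXn.
by rewrite (polySpred b_neq0) size_exp size_oneBX mul1n addSn addnS.
Qed.

(** The quotient of [iter k D (monomial a b)] by [monomial a b]. The recursion is the product rule,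
    [a (1 - X) - b X] being the logarithmic derivative of the monomial for [D]. *)
Fixpoint monomial_factor (a b k : nat) : {poly K} :=
  if k is j.+1 then
    D (monomial_factor a b j) +
    monomial_factor a b j * (a%:R *: (1 - 'X) - b%:R *: 'X)
  else 1.

Lemma scaled_deriv_monomial a b :
  D (monomial a b) = (a%:R *: (1 - 'X) - b%:R *: 'X) * monomial a b.
Proof.
have DX : D 'X^a = (a%:R *: (1 - 'X)) * 'X^a.
  rewrite /scaled_deriv derivXn; case: a => [|a].
    by rewrite mulr0n mulr0 scale0r mul0r.
  by rewrite exprS scaler_nat /=; ring.
have DY : D ((1 - 'X) ^+ b) = - (b%:R *: 'X) * (1 - 'X) ^+ b.
  rewrite /scaled_deriv deriv_exp derivB derivC derivX sub0r.
  case: b => [|b]; first by rewrite mulr0n mulr0 scale0r oppr0 mul0r.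
  by rewrite exprS scaler_nat /=; ring.
by rewrite /monomial scaled_derivM DX DY; ring.
Qed.

Lemma iter_scaled_deriv_monomial a b k :
  iter k D (monomial a b) = monomial_factor a b k * monomial a b.
Proof.
elim: k => [|k IHk] /=; first by rewrite mul1r.
by rewrite IHk scaled_derivM scaled_deriv_monomial; ring.
Qed.

(** [D] differentiates and multiplies by a quadratic, and the other summand gains a linear factor,
    so each step raises the degree by at most 1. *)
Lemma size_monomial_factor a b k : (size (monomial_factor a b k) <= k.+1)%N.
Proof.
elim: k => [|k IHk] /=; first by rewrite size_poly1.
apply: (leq_trans (size_polyD _ _)); rewrite geq_max; apply/andP; split.
  apply: (leq_trans (size_polyMleq _ _)).
  have : (size (monomial_factor a b k)^`() <= (size (monomial_factor a b k)).-1)%N.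
    exact: size_poly.
  rewrite size_mul ?polyX_eq0 ?oneBX_neq0 // size_polyX size_oneBX; lia.
apply: (leq_trans (size_polyMleq _ _)).
have : (size (a%:R *: (1 - 'X) - b%:R *: 'X : {poly K})%R <= 2)%N.
  apply: (leq_trans (size_polyD _ _)); rewrite size_polyN geq_max.
  by rewrite !(leq_trans (size_scale_leq _ _)) ?size_oneBX ?size_polyX.
lia.
Qed.

Lemma iter_scaled_deriv_sum (I : Type) (r : seq I) (c : I -> K) (f : I -> {poly K}) k :
  iter k D (\sum_(i <- r) c i *: f i) = \sum_(i <- r) c i *: iter k D (f i).
Proof.
elim: k => //= k ->; rewrite scaled_deriv_sum; apply: eq_bigr => i _.
by rewrite /scaled_deriv derivZ scalerAr.
Qed.

(* Cramer's rule for the system of the derivatives of order [0..n] of the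
   relation, whose unknowns are the [c i *: monomial (nu i) (mu i)]. *)
Lemma free_monomial_degree n (c : 'I_n.+1 -> K) (nu mu : 'I_n.+1 -> nat) :
  (forall l : 'I_n.+1 -> K,
     \sum_i l i *: monomial (nu i) (mu i) = 0 -> forall i, l i = 0) ->
  (forall i, c i != 0) -> \sum_i c i *: monomial (nu i) (mu i) = 1 ->
  forall i, (nu i + mu i <= n * n)%N.
Proof.
move=> f_free c_neq0 sum1 i.
pose G := \matrix_(k < n.+1, j < n.+1) monomial_factor (nu j) (mu j) k.
pose F := \col_(j < n.+1) (c j *: monomial (nu j) (mu j)).
have detG : \det G != 0.
  have p_neq0 : 'X * (1 - 'X) != 0 :> {poly K}.
    by rewrite mulf_neq0 ?polyX_eq0 ?oneBX_neq0.
  have := wronskian_neq0 p_neq0 f_free.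
  have -> : \matrix_(k < n.+1, j < n.+1) iter k D (monomial (nu j) (mu j)) =
            G *m diag_mx (\row_j monomial (nu j) (mu j)).
    by apply/matrixP=> k j; rewrite mul_mx_diag !mxE iter_scaled_deriv_monomial.
  by rewrite det_mulmx mulf_eq0 negb_or => /andP[].
(* Row [k] is [D^k] applied to the constant 1, hence 0 for [k > 0]. *)
have GF : G *m F = delta_mx 0 0.
  apply/colP => k; rewrite !mxE.
  transitivity (iter k D (\sum_j c j *: monomial (nu j) (mu j))).
    rewrite iter_scaled_deriv_sum; apply: eq_bigr => j _.
    by rewrite !mxE iter_scaled_deriv_monomial [RHS]scalerAr.
  rewrite sum1; case: k => -[|k] k_lt //=.
  elim: k {k_lt} => [|k /= ->].
    by rewrite /scaled_deriv /= derivC mulr0.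
  by rewrite /scaled_deriv deriv0 mulr0.
have /colP/(_ i) : \adj G *m (G *m F) = \adj G *m delta_mx 0 0 by rewrite GF.
rewrite mulmxA mul_adj_mx mul_scalar_mx -colE !mxE => cramer.
(* A cofactor is a sum of products of [n] entries, each of degree at most [n]. *)
have : (size (cofactor G 0%R i) <= (n * n).+1)%N.
  apply: size_cofactor_leq => k j; rewrite mxE.
  by apply: leq_trans (size_monomial_factor _ _ _) _; rewrite ltn_ord.
rewrite -cramer size_mul ?scaler_eq0 ?negb_or ?c_neq0 ?monomial_neq0 //.
rewrite size_scale // size_monomial (polySpred detG); lia.
Qed.

End Monomials.

(** * Finiteness of the set of fundamental models *)

Section Models.
Variables (R : realType) (n : nat).
Implicit Types (c : 'I_n.+1 -> R) (nu mu : 'I_n.+1 -> nat).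

Lemma reduced_model_poly c nu mu : is_reduced_model c nu mu ->
  \sum_i c i *: monomial R (nu i) (mu i) = 1.
Proof.
move=> model; apply/eqP; rewrite -subr_eq0; apply/negPn/negP.
move=> /poly_nonroot_itv[t t01]; rewrite hornerD hornerN hornerC horner_sum.
rewrite (eq_bigr (fun i => c i * t ^+ nu i * (1 - t) ^+ mu i)).
  by rewrite (sum_eq1 model) // subrr eqxx.
by move=> i _; rewrite hornerZ hornerM !horner_exp !hornerE.
Qed.

(** Adding a small multiple of a linear relation [l] to [c] keeps the scalings positive and the sum
    equal to 1, so uniqueness forces [l = 0]. *)
Lemma fundamental_model_free c nu mu : is_fundamental_model c nu mu ->
  forall l : 'I_n.+1 -> R,
    \sum_i l i *: monomial R (nu i) (mu i) = 0 -> forall i, l i = 0.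
Proof.
move=> [model c_uniq] l l0 i; have c_gt0 := scaling_gt0 model.
(* [T] is large enough that [l j / T] is smaller than [c j] in absolute value for every [j]; the
   [+ 1] makes this strict and [T] positive even for [l = 0]. *)
pose T := \sum_j (`|l j| + 1) / c j.
have term_gt0 j : 0 < (`|l j| + 1) / c j.
  by rewrite divr_gt0 // ltr_wpDl.
have l_lt j : `|l j| < c j * T.
  rewrite mulrC -ltr_pdivrMr // /T (bigD1 j) //=.
  apply: (@lt_le_trans _ _ ((`|l j| + 1) / c j)).
    by rewrite ltr_pM2r ?invr_gt0 // ltrDl.
  by rewrite lerDl sumr_ge0 // => k _; exact: ltW.
have T_gt0 : 0 < T by rewrite -(pmulr_rgt0 _ (c_gt0 i)) (le_lt_trans _ (l_lt i)).
have : c i + l i / T = c i.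
  apply: (c_uniq (fun j => c j + l j / T)) => [j|].
    rewrite -(pmulr_lgt0 _ T_gt0) mulrDl divfK ?gt_eqF //.
    by rewrite -ltrBlDl sub0r ltrNl (le_lt_trans _ (l_lt j)) // -normrN ler_norm.
  under eq_bigr do rewrite scalerDl [_ / T]mulrC -scalerA.
  by rewrite big_split /= -scaler_sumr l0 scaler0 addr0 reduced_model_poly.
move/eqP; rewrite -subr_eq0 addrAC subrr add0r mulf_eq0 invr_eq0 (gt_eqF T_gt0).
by rewrite orbF => /eqP.
Qed.

Lemma fundamental_model_degree c nu mu : is_fundamental_model c nu mu ->
  forall i, (nu i + mu i <= n * n)%N.
Proof.
move=> model; apply: (free_monomial_degree (c := c) (fundamental_model_free model)).
  by move=> i; rewrite gt_eqF // (scaling_gt0 model.1).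
exact: reduced_model_poly model.1.
Qed.

Lemma fundamental_model_unique c c' nu mu :
  is_fundamental_model c nu mu -> is_fundamental_model c' nu mu -> c = c'.
Proof.
move=> [_ c_uniq] [model' _]; apply/funext => i; apply/esym/c_uniq.
  exact: scaling_gt0 model'.
exact: reduced_model_poly model'.
Qed.

End Models.

Theorem corollary2p3 (R : realType) (n : nat) :
  finite_set (fundamental_models R n).
Proof.
pose E := {ffun 'I_n.+1 -> 'I_(n * n).+1 * 'I_(n * n).+1}.
pose nu (e : E) i : nat := (e i).1; pose mu (e : E) i : nat := (e i).2.
pose model (e : E) (c : 'I_n.+1 -> R) := range (fun i => (c i, nu e i, mu e i)).
(* The default 0 is taken at exponents that carry no fundamental model; it only enlarges the finite
   covering set. *)
pose scaling (e : E) : 'I_n.+1 -> R :=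
  xget (fun=> 0) [set c | is_fundamental_model c (nu e) (mu e)].
apply: (@sub_finite_set _ _ (range (fun e => model e (scaling e)))); last first.
  exact/finite_image/finite_finset.
move=> _ [c [nu' [mu' [c_fund ->]]]].
have deg := fundamental_model_degree c_fund.
pose e : E := [ffun i => (inord (nu' i), inord (mu' i))].
have nuE : nu e = nu'.
  by apply/funext => i; rewrite /nu ffunE inordK // ltnS (leq_trans _ (deg i)) ?leq_addr.
have muE : mu e = mu'.
  by apply/funext => i; rewrite /mu ffunE inordK // ltnS (leq_trans _ (deg i)) ?leq_addl.
have scalingE : scaling e = c.
  rewrite /scaling nuE muE; apply: xget_subset1 => // c1 c2 c1_fund c2_fund.
  exact: fundamental_model_unique c1_fund c2_fund.
by exists e => //; rewrite /model scalingE nuE muE.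
Qed.
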